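(* For integers $m\ge k\ge0$, \[ \frac{(-1)^{m-k}}{m+1}\binom{m+1}{m-k}B_{m-k}=\sum_{\ell=k}^m\frac{S(m,\ell)}{\ell+1}\bigl[s(\ell,k+1)+s(\ell,k)\bigr]. \]
   Context: $s(k,r)$ are the (signed) Stirling numbers of the first kind, defined by $x^{\underline{k}}=x(x-1)\cdots(x-k+1)=\sum_{r=0}^k s(k,r)x^r$ (with $s(k,r)=0$ for $r>k$ or $r<0$); $S(m,\ell)$ are the Stirling numbers of the second kind ($S(0,0)=1$, $S(m,0)=0$ for $m\ge1$). The Bernoulli numbers are $B_0=1$ and $B_k=-\frac{1}{k+1}\sum_{j=0}^{k-1}\binom{k+1}{j}B_j$ for $k\ge1$ (so $B_1=-1/2$). *)

(* Defs.v *)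
From HB Require Import structures.
From mathcomp Require Import all_boot all_order all_algebra.

Set Implicit Arguments.
Unset Strict Implicit.
Unset Printing Implicit Defensive.

Import Order.TTheory GRing.Theory Num.Theory.
Local Open Scope ring_scope.

Definition falling_poly (k : nat) : {poly int} := \prod_(i < k) ('X - i%:R).

Definition stirling1 (k r : nat) : int := (falling_poly k)`_r.

Definition stirling2 (m l : nat) : nat :=
  #|[set P : {set {set 'I_m}} | partition P [set: 'I_m] & #|P| == l]|.

(* bernoulli_seq n = [:: B_0; ...; B_(n-1)]; the defining recursion of the B_k
   is recovered by the lemmas bernoulli0 and bernoulliE below. *)
Fixpoint bernoulli_seq (n : nat) : seq rat :=
  if n is k.+1 then
    let s := bernoulli_seq k in
    rcons s (if k == 0%N then 1
             else - (k.+1%:R)^-1 * \sum_(j < k) 'C(k.+1, j)%:R * s`_j)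
  else [::].

Definition bernoulli (k : nat) : rat := (bernoulli_seq k.+1)`_k.

Lemma size_bernoulli_seq n : size (bernoulli_seq n) = n.
Proof. by elim: n => //= n IHn; rewrite size_rcons IHn. Qed.

Lemma nth_bernoulli_seq n j : (j < n)%N -> (bernoulli_seq n)`_j = bernoulli j.
Proof.
elim: n => // n IHn; rewrite ltnS leq_eqVlt => /predU1P[-> // | ltjn].
by rewrite /= nth_rcons size_bernoulli_seq ltjn IHn.
Qed.

Lemma bernoulli0 : bernoulli 0 = 1.
Proof. by []. Qed.

Lemma bernoulliE k : (0 < k)%N ->
  bernoulli k = - (k.+1%:R)^-1 * \sum_(j < k) 'C(k.+1, j)%:R * bernoulli j.
Proof.
move=> k_gt0; rewrite {1}/bernoulli /= nth_rcons size_bernoulli_seq ltnn eqxx.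
rewrite eqn0Ngt k_gt0 /=; congr (_ * _); apply: eq_bigr => j _.
by rewrite nth_bernoulli_seq.
Qed.

Lemma stirling2_00 : stirling2 0 0 = 1%N.
Proof.
rewrite /stirling2 -(cards1 (set0 : {set {set 'I_0}})); congr #|pred_of_set _|.
apply/setP=> P; rewrite !inE cards_eq0.
apply/andP/eqP => [[_ /eqP] // | ->]; split=> //.
apply/and3P; split; last by rewrite in_set0.
  by apply/eqP/setP=> -[].
by apply/trivIsetP=> A B; rewrite in_set0.
Qed.

Lemma stirling2_S0 m : stirling2 m.+1 0 = 0%N.
Proof.
apply/eqP; rewrite cards_eq0; apply/eqP/setP=> P; rewrite !inE cards_eq0.
apply/negP=> /andP[/cover_partition covP /eqP P0].
by have := in_setT (ord0 : 'I_m.+1); rewrite -covP P0 /cover big_set0 inE.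
Qed.

(* Main.v *)
Require Import Defs.
From HB Require Import structures.
From mathcomp Require Import all_boot all_order all_algebra.
From mathcomp Require Import ring zify.

Set Implicit Arguments.
Unset Strict Implicit.
Unset Printing Implicit Defensive.

Import Order.TTheory GRing.Theory Num.Theory.
Local Open Scope ring_scope.

(** Both [stirling_power_poly m] and [bernoulli_power_poly m] are polynomials
    [p] with [p(n+1) - p(n) = (n+1)^m] at every natural number [n], so they
    differ by a constant, and the theorem equates their coefficients of degree
    [k+1].  On the Stirling side, the difference of [(x+1) x^_l / (l+1)] at [n]
    is [(n+1)^_l], and [sum_l S(m,l) x^_l = x^m] follows by sorting the maps
    from ['I_m] to ['I_n] according to their kernel partition.  On the Bernoulli
    side, the signs [(-1)^j] come from substituting [-y] in the usual Faulhaber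
    polynomial, so the vanishing of the odd Bernoulli numbers is not needed. *)

(** * Kernel partitions and falling factorials *)

Section FunctionsWithKernel.

Variables (T R : finType) (P : {set {set T}}).
Hypothesis partP : partition P [set: T].

Let tiP : trivIset P.
Proof. by case/and3P: partP. Qed.

Let covP x : x \in cover P.
Proof. by rewrite (cover_partition partP) inE. Qed.

Let block := {B : {set T} | B \in P}.
Let block_of (x : T) : block := Sub (pblock P x) (pblock_mem (covP x)).

Let block_inh (b : block) : exists x, x \in val b.
Proof.
by apply/set0Pn; apply: contraTneq (valP b) => ->; case/and3P: partP.
Qed.

Let block_ofK (b : block) x : x \in val b -> block_of x = b.
Proof. by move=> xb; apply/val_inj/(def_pblock tiP (valP b) xb). Qed.

(** Such a map is constant on each block of [P] and separates distinct blocks, so it amounts to an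
    injection from the blocks into [R]; [lift] is this correspondence. *)
Lemma card_preim_partition :
  #|[set f : {ffun T -> R} | preim_partition f [set: T] == P]|
  = (#|R| ^_ #|P|)%N.
Proof.
pose lift (g : {ffun block -> R}) := [ffun x => g (block_of x)].
have lift_inj : injective lift.
  move=> g1 g2 /ffunP eq12; apply/ffunP=> b; have [x xb] := block_inh b.
  by have := eq12 x; rewrite !ffunE (block_ofK xb).
have -> : #|P| = #|{: block}| by rewrite card_sig; apply: eq_card.
rewrite -card_inj_ffuns -(card_imset _ lift_inj).
congr #|pred_of_set _|; apply/setP=> f; rewrite inE.
apply/eqP/imsetP=> [kerf | [g]].
  have kerfE x y : (y \in pblock P x) = (f x == f y).
    rewrite -kerf; apply: (@pblock_equivalence_partition _
      [rel x y | f x == f y]); rewrite ?inE //.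
    by split=> //= /eqP->.
  pose g := [ffun b => f (xchoose (block_inh b))].
  exists g.
    rewrite inE; apply/injectiveP=> b1 b2; rewrite !ffunE => /eqP.
    rewrite -kerfE => /(@block_ofK (block_of _)).
    by rewrite !(block_ofK (xchooseP (block_inh _))).
  apply/ffunP=> x; rewrite !ffunE; apply/eqP; rewrite -kerfE.
  exact: (xchooseP (block_inh (block_of x))).
rewrite inE => /injectiveP g_inj ->.
(* With [P] seen as the kernel partition of [pblock P], it suffices that [lift g] and [pblock P]
   identify the same points. *)
rewrite -[RHS](preim_partition_pblock partP).
rewrite /preim_partition /equivalence_partition.
apply: eq_imset => x; apply/setP=> y; rewrite !inE !ffunE.
by rewrite (inj_eq g_inj) -val_eqE.
Qed.

End FunctionsWithKernel.

Lemma leq_card_partition (T : finType) (P : {set {set T}}) (D : {set T}) :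
  partition P D -> (#|P| <= #|D|)%N.
Proof.
move=> partP; rewrite (card_partition partP) -sum1_card leq_sum // => B BP.
by rewrite card_gt0; apply: contraTneq BP => ->; case/and3P: partP.
Qed.

Lemma expn_sum_stirling2 (n m : nat) :
  (n ^ m = \sum_(l < m.+1) stirling2 m l * n ^_ l)%N.
Proof.
rewrite -{1}(card_ord n) -{1}(card_ord m) -card_ffun -sum1_card.
rewrite (partition_big (fun f : {ffun 'I_m -> 'I_n} =>
  preim_partition f [set: 'I_m])
  (fun P => partition P [set: 'I_m])) => [|f _]; last exact: preim_partitionP.
(* [inord] is faithful here, since a partition of [m] points has at most [m] blocks. *)
rewrite (partition_big (fun P : {set {set 'I_m}} => inord #|P| : 'I_m.+1)
  xpredT) //=.
apply: eq_bigr => l _; rewrite /stirling2 -sum1_card big_distrl /=.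
have cardE (P : {set {set 'I_m}}) : partition P [set: 'I_m] ->
    (inord #|P| == l :> 'I_m.+1) = (#|P| == l).
  move=> partP; rewrite -val_eqE /= inordK // ltnS.
  by rewrite (leq_trans (leq_card_partition partP)) // cardsT card_ord.
apply: eq_big => [P | P /andP[partP]].
  by rewrite inE; case: (boolP (partition P _)) => //= /cardE.
rewrite (cardE _ partP) => /eqP <-; rewrite mul1n.
have := card_preim_partition 'I_n partP; rewrite card_ord => <-.
by rewrite -sum1_card; apply: eq_bigl => f; rewrite inE.
Qed.

Lemma horner_falling_poly (R : comNzRingType) (l n : nat) :
  (map_poly (intr : int -> R) (falling_poly l)).[n%:R] = (n ^_ l)%:R.
Proof.
elim: l => [|l IHl]; first by rewrite /falling_poly big_ord0 rmorph1 hornerC.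
rewrite /falling_poly big_ord_recr /= rmorphM hornerM IHl ffactnSr natrM.
rewrite rmorphB /= map_polyX rmorph_nat !hornerE.
(* The truncated [n - l] is wrong only for [n < l], where [n ^_ l] vanishes. *)
have [ltnl | leln] := ltnP n l; first by rewrite ffact_small // !mul0r.
by rewrite natrB // -polyC_natr hornerC.
Qed.

(** * Bernoulli polynomials and their differences *)

Lemma bernoulli_sum (p : nat) :
  \sum_(j < p.+1) 'C(p.+1, j)%:R * bernoulli j = (p == 0%N)%:R.
Proof.
rewrite big_ord_recr /= binSn; case: p => [|p].
  by rewrite big_ord0 add0r mul1r.
rewrite bernoulliE // mulrA mulrN divff ?mulN1r ?subrr //.
by rewrite pnatr_eq0.
Qed.

(** Either side times [i! j! (n - i - j)!] is [n!]. *)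
Lemma bin_mul_subl (n i j : nat) : (i + j <= n)%N ->
  ('C(n, j) * 'C(n - j, i) = 'C(n, i) * 'C(n - i, j))%N.
Proof.
move=> leijn.
have F a b : (a + b <= n)%N ->
  ('C(n, b) * 'C(n - b, a) * (a`! * b`! * (n - (a + b))`!) = n`!)%N.
  move=> leab; rewrite -(@bin_fact n b); last by lia.
  rewrite -(@bin_fact (n - b) a); last by lia.
  by rewrite -subnDA [(b + a)%N]addnC; lia.
have := F i j leijn; rewrite addnC in leijn.
rewrite -(F j i leijn) [(j + i)%N]addnC [(j`! * _)%N]mulnC => /eqP.
by rewrite eqn_pmul2r ?muln_gt0 ?fact_gt0 // => /eqP.
Qed.

(** The Bernoulli polynomial of degree [m.+1] without its constant term. *)
Definition bernoulli_power_sum (m : nat) (y : rat) : rat :=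
  \sum_(j < m.+1) 'C(m.+1, j)%:R * bernoulli j * y ^+ (m.+1 - j).

Lemma exprD1_sub (R : comNzRingType) (y : R) (p : nat) :
  (y + 1) ^+ p - y ^+ p = \sum_(i < p) 'C(p, i)%:R * y ^+ i.
Proof.
rewrite [y + 1]addrC exprDn big_ord_recr /= binn subnn mulr1n expr0 mul1r addrK.
by apply: eq_bigr => i _; rewrite expr1n mul1r mulr_natl.
Qed.

(** After exchanging the sums, the coefficient of [y ^+ i] carries the sum of [bernoulli_sum] at
    [p = m - i], which vanishes unless [i = m]. *)
Lemma bernoulli_power_sumD1 (m : nat) (y : rat) :
  bernoulli_power_sum m (y + 1) - bernoulli_power_sum m y = m.+1%:R * y ^+ m.
Proof.
rewrite /bernoulli_power_sum -sumrB.
transitivity (\sum_(j < m.+1) \sum_(i < m.+1 | (i + j < m.+1)%N)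
   ('C(m.+1, i)%:R * y ^+ i) * ('C(m.+1 - i, j)%:R * bernoulli j)).
  apply: eq_bigr => j _; rewrite -mulrBr exprD1_sub big_distrr /=.
  rewrite (big_ord_widen m.+1 (fun i => _ * ('C(m.+1 - j, i)%:R * y ^+ i)));
    last exact: leq_subr.
  apply: eq_big => [i | i ltij]; first by lia.
  have /bin_mul_subl/(congr1 (GRing.natmul (1 : rat))) : (i + j <= m.+1)%N.
    by lia.
  by rewrite !natrM => E; ring: E.
rewrite (exchange_big_dep xpredT) //=.
transitivity (\sum_(i < m.+1) 'C(m.+1, i)%:R * y ^+ i * (i == m :> nat)%:R).
  apply: eq_bigr => i _; rewrite -big_distrr /=; congr (_ * _).
  have -> : (i == m :> nat) = (m - i == 0)%N by have := ltn_ord i; lia.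
  have leim : (i <= m)%N by rewrite -ltnS.
  rewrite -bernoulli_sum -subSn //.
  rewrite (big_ord_widen m.+1 (fun j => 'C(m.+1 - i, j)%:R * bernoulli j));
    last exact: leq_subr.
  by apply: eq_bigl => j; lia.
rewrite big_ord_recr /= eqxx mulr1 big1 ?add0r ?binSn // => i _.
by rewrite ltn_eqF ?mulr0.
Qed.

(** * Polynomials compared at natural numbers *)

Lemma horner_nat_const (R : numDomainType) (p : {poly R}) (c : R) :
  (forall n : nat, p.[n%:R] = c) -> p = c%:P.
Proof.
move=> pc; apply/eqP; rewrite -subr_eq0; apply/eqP.
apply: (@roots_geq_poly_eq0 _ _
  [seq n%:R | n <- iota 0 (size (p - c%:P))]).
- by apply/allP=> _ /mapP[n _ ->]; rewrite /root !hornerE pc subrr.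
- by rewrite map_inj_uniq ?iota_uniq // => a b /eqP; rewrite eqr_nat => /eqP.
- by rewrite size_map size_iota.
Qed.

(** By induction [p - q] keeps its value at 0 on all naturals, so it is constant; the index [k.+1]
    avoids the constant coefficient. *)
Lemma coef_eq_nat_diff (R : numDomainType) (p q : {poly R}) (k : nat) :
  (forall n : nat, p.[n.+1%:R] - p.[n%:R] = q.[n.+1%:R] - q.[n%:R]) ->
  p`_k.+1 = q`_k.+1.
Proof.
move=> dpq; have pqc (n : nat) : (p - q).[n%:R] = (p - q).[0].
  elim: n => // n <-; rewrite !hornerE.
  have := dpq n; move/eqP; rewrite subr_eq => /eqP ->; ring.
by apply/eqP; rewrite -subr_eq0 -coefB (horner_nat_const pqc) coefC.
Qed.

(** * The two power-sum polynomials and their coefficients *)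

Definition stirling_power_poly (m : nat) : {poly rat} :=
  \sum_(l < m.+1) ((stirling2 m l)%:R / l.+1%:R) *:
    (('X + 1) * map_poly intr (falling_poly l)).

Definition bernoulli_power_poly (m : nat) : {poly rat} :=
  \sum_(j < m.+1)
    ((-1) ^+ j / m.+1%:R * 'C(m.+1, j)%:R * bernoulli j) *: 'X^(m.+1 - j).

Lemma stirling_power_poly_diff (m n : nat) :
  (stirling_power_poly m).[n.+1%:R] - (stirling_power_poly m).[n%:R]
  = n.+1%:R ^+ m.
Proof.
rewrite /stirling_power_poly !horner_sum -sumrB -natrX expn_sum_stirling2.
rewrite natr_sum; apply: eq_bigr => l _.
rewrite !hornerE !horner_falling_poly natrM.
(* The factor ['X + 1] raises both falling factorials to order [l.+1], one at [n.+2] and one at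
   [n.+1]; their difference is given by a Pascal-type rule. *)
rewrite !natr1 /= -!mulrA -[n.+2%:R * _]natrM -[n.+1%:R * _]natrM -!ffactSS.
have -> : (n.+2 ^_ l.+1 = l.+1 * n.+1 ^_ l + n.+1 ^_ l.+1)%N.
  rewrite ffactSS ffactnSr.
  have [ltnl | leln] := ltnP n.+1 l; first by rewrite ffact_small // !muln0.
  by rewrite [(_ * (_ - _))%N]mulnC -mulnDl; congr (_ * _)%N; lia.
by rewrite natrD natrM; field; rewrite nat1r pnatr_eq0.
Qed.

Lemma bernoulli_power_polyE (m : nat) (y : rat) :
  (bernoulli_power_poly m).[y]
  = (-1) ^+ m.+1 / m.+1%:R * bernoulli_power_sum m (- y).
Proof.
rewrite /bernoulli_power_poly horner_sum /bernoulli_power_sum big_distrr /=.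
apply: eq_bigr => j _; rewrite !hornerE [(- y) ^+ _]exprNn.
have lejm : (j <= m.+1)%N by rewrite ltnW.
(* The part [(-1) ^+ (m.+1 - j)] cancels the sign of the power of [- y] and leaves [(-1) ^+ j]. *)
rewrite -[in (-1) ^+ m.+1](subnK lejm) exprD.
have E : (-1) ^+ (m.+1 - j) * (-1) ^+ (m.+1 - j) = 1 :> rat.
  by rewrite -exprMn mulrNN mulr1 expr1n.
move: E; set e := (-1) ^+ (m.+1 - j); set z := y ^+ _ => E.
by rewrite /=; ring: E.
Qed.

Lemma bernoulli_power_poly_diff (m n : nat) :
  (bernoulli_power_poly m).[n.+1%:R] - (bernoulli_power_poly m).[n%:R]
  = n.+1%:R ^+ m.
Proof.
rewrite !bernoulli_power_polyE -mulrBr -opprB.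
(* Negation reverses the step: it now starts at [- n.+1%:R], hence the power of [n.+1] rather than
   of [n]. *)
have -> : - n%:R = - n.+1%:R + 1 :> rat by rewrite -natr1; ring.
rewrite bernoulli_power_sumD1 [(- _%:R) ^+ m]exprNn exprS.
have E : (-1) ^+ m * (-1) ^+ m = 1 :> rat.
  by rewrite -exprMn mulrNN mulr1 expr1n.
move: E; set e := (-1) ^+ m; set z := n.+1%:R ^+ m => E.
by rewrite /=; field: E; rewrite nat1r pnatr_eq0.
Qed.

Lemma coef_stirling_power_poly (m k : nat) :
  (stirling_power_poly m)`_k.+1
  = \sum_(l < m.+1) (stirling2 m l)%:R / l.+1%:R
      * ((stirling1 l k.+1)%:~R + (stirling1 l k)%:~R).
Proof.
rewrite coef_sum; apply: eq_bigr => l _.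
(* In ['X + 1], the term ['X] shifts the index and yields [stirling1 l k]; the term 1 yields
   [stirling1 l k.+1]. *)
by rewrite coefZ mulrDl mul1r coefD coefXM /= !coef_map addrC.
Qed.

Lemma coef_bernoulli_power_poly (m k : nat) : (k <= m)%N ->
  (bernoulli_power_poly m)`_k.+1
  = (-1) ^+ (m - k) / m.+1%:R * 'C(m.+1, m - k)%:R * bernoulli (m - k).
Proof.
move=> lekm; have ltmk : (m - k < m.+1)%N by rewrite ltnS leq_subr.
rewrite coef_sum (bigD1 (Ordinal ltmk)) //= coefZ coefXn.
have -> : k.+1 == (m.+1 - (m - k))%N by lia.
rewrite mulr1 big1 ?addr0 // => j; rewrite -val_eqE /= => nejmk.
rewrite coefZ coefXn; have -> : (k.+1 == m.+1 - j)%N = false.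
  by have := ltn_ord j; lia.
by rewrite mulr0.
Qed.

Lemma stirling1_small (l r : nat) : (l < r)%N -> stirling1 l r = 0.
Proof.
move=> ltlr; rewrite /stirling1 nth_default // /falling_poly.
under eq_bigr => i _ do rewrite -polyC_natr.
by rewrite size_prod_XsubC /index_enum -enumT size_enum_ord.
Qed.

Theorem theorem6 (m k : nat) (hkm : (k <= m)%N) :
  (-1) ^+ (m - k) / m.+1%:R * 'C(m.+1, m - k)%:R * bernoulli (m - k)
  = \sum_(k <= l < m.+1)
      (stirling2 m l)%:R / l.+1%:R
      * ((stirling1 l k.+1)%:~R + (stirling1 l k)%:~R) :> rat.
Proof.
rewrite -coef_bernoulli_power_poly //.
rewrite -(@coef_eq_nat_diff _ (stirling_power_poly m)) => [|n]; last first.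
  by rewrite stirling_power_poly_diff bernoulli_power_poly_diff.
rewrite coef_stirling_power_poly.
rewrite -(big_mkord xpredT (fun l => (stirling2 m l)%:R / l.+1%:R
  * ((stirling1 l k.+1)%:~R + (stirling1 l k)%:~R))).
(* For [l < k] both Stirling numbers exceed the degree [l] of the falling factorial in their second
   index, so these terms vanish. *)
rewrite (big_cat_nat (leq0n k) (leqW hkm)) /= big_nat big1 ?add0r //.
move=> l /andP[_ ltlk].
by rewrite !stirling1_small ?addr0 ?mulr0 // ltnW // ltnS ltnW.
Qed.
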